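(* Let $|\mathrm{W}\rangle=\frac{1}{\sqrt3}(|100\rangle+|010\rangle+|001\rangle)\in(\mathbb{C}^2)^{\otimes 3}$. For every normalized pure three-qubit state $|\psi\rangle\in(\mathbb{C}^2)^{\otimes3}$ one has $G(|\psi\rangle)^2\ge G(|\mathrm{W}\rangle)^2=\frac49$, equivalently $E_G(|\psi\rangle)\le E_G(|\mathrm{W}\rangle)=\frac59$. Moreover equality holds if and only if $|\psi\rangle=e^{i\phi}(U_1\otimes U_2\otimes U_3)|\mathrm{W}\rangle$ for some single-qubit unitaries $U_1,U_2,U_3$ and some phase $\phi\in\mathbb{R}$; i.e. up to local unitary transformations the W state is the unique maximally entangled pure three-qubit state with respect to the geometric measure.
   Context: For a normalized pure state $|\psi\rangle$ of an $n$-partite system, $G(|\psi\rangle):=\max |\langle a_1|\langle a_2|\cdots\langle a_n|\,\psi\rangle|$, the maximum taken over all normalized single-party states $|a_1\rangle,\dots,|a_n\rangle$ of the respective subsystems. The geometric measure of entanglement is $E_G(|\psi\rangle):=1-G(|\psi\rangle)^2$. *)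

(* Defs.v *)
From HB Require Import structures.
From mathcomp Require Import all_boot all_order all_algebra.
Set Implicit Arguments. Unset Strict Implicit. Unset Printing Implicit Defensive.
Import Order.TTheory GRing.Theory Num.Theory.
Local Open Scope ring_scope.

Section QuantumDefs.
Variable C : numClosedFieldType.

(* single-qubit vector in C^2, and three-qubit vector in (C^2)^{(x)3},
   indexed by computational basis labels *)
Definition qubit := 'I_2 -> C.
Definition state3 := 'I_2 -> 'I_2 -> 'I_2 -> C.

Definition qnormalized (a : qubit) : Prop := \sum_(i < 2) `|a i| ^+ 2 = 1.

Definition normalized3 (psi : state3) : Prop :=
  \sum_(i < 2) \sum_(j < 2) \sum_(k < 2) `|psi i j k| ^+ 2 = 1.

Definition overlap (a1 a2 a3 : qubit) (psi : state3) : C :=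
  \sum_(i < 2) \sum_(j < 2) \sum_(k < 2)
     (a1 i)^* * (a2 j)^* * (a3 k)^* * psi i j k.

Definition is_G (psi : state3) (g : C) : Prop :=
  (forall a1 a2 a3 : qubit, qnormalized a1 -> qnormalized a2 -> qnormalized a3 ->
      `|overlap a1 a2 a3 psi| <= g) /\
  (exists a1 a2 a3 : qubit, [/\ qnormalized a1, qnormalized a2, qnormalized a3 &
      `|overlap a1 a2 a3 psi| = g]).

Definition E_G (g : C) : C := 1 - g ^+ 2.

Definition Wstate : state3 :=
  fun i j k => if (i + j + k == 1)%N then (sqrtC 3)^-1 else 0.

Definition unitary2 (U : 'M[C]_2) : Prop := U *m (map_mx Num.conj U)^T = 1%:M.

Definition local_op (U1 U2 U3 : 'M[C]_2) (psi : state3) : state3 :=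
  fun i j k => \sum_(a < 2) \sum_(b < 2) \sum_(c < 2)
     U1 i a * U2 j b * U3 k c * psi a b c.

End QuantumDefs.

(* Main.v *)
(* Rotate psi by local unitaries so that its closest product state is |000>.
   Stationarity of the overlap leaves psi = g (|000> + al |011> + be |101> +
   ga |110> + de |111>).  Contracting the first qubit with a vector x of squared
   norm N gives a 2x2 matrix M(x) of operator norm at most g sqrt N, hence
   N^2 - N tr (M M^H) / g^2 + |det M|^2 / g^4 >= 0 ([detform]).  Writing x in
   suitable phases, this is, for every real direction (w1, w2), a quadratic
   polynomial in the remaining real parameter; its discriminant being
   nonpositive in well-chosen directions yields, with S = |al|^2+|be|^2+|ga|^2
   and p = |al be ga|,
     S + 2 p <= 1   and   S + |de|^2 <= 1 + 2 p.
   The first inequality and AM-GM give p <= 1/8, so that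
   1 / g^2 = 1 + S + |de|^2 <= 9/4.  In the equality case al, be, ga have modulus
   1/2 and de^2 = -4 al be ga, which determines psi up to local phases: it is W
   written in a basis attached to one of its closest product states. *)
Require Import Defs.
From HB Require Import structures.
From mathcomp Require Import all_boot all_order all_algebra.
From mathcomp Require Import ring.
Import Order.TTheory GRing.Theory Num.Theory.
Local Open Scope ring_scope.
Set Implicit Arguments. Unset Strict Implicit. Unset Printing Implicit Defensive.

(** * Local operations *)

Section LocalOperations.
Variable C : numClosedFieldType.
Implicit Types (U V : 'M[C]_2) (psi phi : state3 C) (a : qubit C).

Lemma sum2 (F : 'I_2 -> C) : \sum_(i < 2) F i = F 0 + F 1.
Proof.
by rewrite !big_ord_recl big_ord0 addr0; congr (_ + F _); apply/val_inj.
Qed.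

Lemma ord2P (i : 'I_2) : i = 0 \/ i = 1.
Proof. by case: i => [[|[|//]] ?]; [left|right]; apply/val_inj. Qed.

Lemma eq_local_op U1 U2 U3 phi psi :
  (forall i j k, phi i j k = psi i j k) ->
  forall i j k, local_op U1 U2 U3 phi i j k = local_op U1 U2 U3 psi i j k.
Proof.
move=> e i j k.
by do 3!apply: eq_bigr => ? _; rewrite e.
Qed.

Lemma local_opM U1 U2 U3 V1 V2 V3 psi i j k :
  local_op U1 U2 U3 (local_op V1 V2 V3 psi) i j k =
  local_op (U1 *m V1) (U2 *m V2) (U3 *m V3) psi i j k.
Proof.
rewrite /local_op !sum2 !mxE !sum2.
ring.
Qed.

Lemma local_op1 psi i j k : local_op 1%:M 1%:M 1%:M psi i j k = psi i j k.
Proof.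
rewrite /local_op !sum2 !mxE.
case: (ord2P i) (ord2P j) (ord2P k) => -> [] -> [] -> /=;
by rewrite ?eqxx /= !(mul0r, mul1r, add0r, addr0).
Qed.

Lemma local_opZ c U1 U2 U3 psi i j k :
  local_op U1 U2 U3 (fun i j k => c * psi i j k) i j k =
  c * local_op U1 U2 U3 psi i j k.
Proof. by rewrite /local_op !sum2; ring. Qed.

Definition adj U : 'M[C]_2 := (map_mx Num.conj U)^T.

Lemma adjE U i j : adj U i j = (U j i)^*.
Proof. by rewrite !mxE. Qed.

Lemma unitary2C U : unitary2 U -> adj U *m U = 1%:M.
Proof. exact: mulmx1C. Qed.

Lemma unitary2_adj U : unitary2 U -> unitary2 (adj U).
Proof.
move=> /unitary2C Uu; rewrite /unitary2 -[RHS]Uu; congr (_ *m _).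
by apply/matrixP => i j; rewrite !mxE conjCK.
Qed.

Lemma unitary2M U V : unitary2 U -> unitary2 V -> unitary2 (U *m V).
Proof.
move=> Uu Uv; rewrite /unitary2 map_mxM trmx_mul mulmxA -(mulmxA U) Uv.
by rewrite mulmx1.
Qed.

Definition qsq a : C := `|a 0| ^+ 2 + `|a 1| ^+ 2.

Lemma qnormE a : qnormalized a <-> qsq a = 1.
Proof. by rewrite /qnormalized sum2. Qed.

Definition app_op U a : qubit C := fun i => U i 0 * a 0 + U i 1 * a 1.

Lemma unitary2_qsq U a : unitary2 U -> qsq (app_op U a) = qsq a.
Proof.
move=> /unitary2C/matrixP Uu.
have := Uu 0 0; have := Uu 0 1; have := Uu 1 0; have := Uu 1 1.
rewrite !mxE !sum2 !mxE /= => h11 h10 h01 h00.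
rewrite /qsq /app_op !normCK !rmorphD !rmorphM /=.
transitivity (((U 0 0)^* * U 0 0 + (U 1 0)^* * U 1 0) * (a 0 * (a 0)^*)
 + ((U 0 0)^* * U 0 1 + (U 1 0)^* * U 1 1) * (a 1 * (a 0)^*)
 + ((U 0 1)^* * U 0 0 + (U 1 1)^* * U 1 0) * (a 0 * (a 1)^*)
 + ((U 0 1)^* * U 0 1 + (U 1 1)^* * U 1 1) * (a 1 * (a 1)^*)); first by ring.
by rewrite h00 h01 h10 h11 !(mul0r, mul1r, addr0).
Qed.

Lemma overlap_local_op a1 a2 a3 U1 U2 U3 psi :
  overlap a1 a2 a3 (local_op U1 U2 U3 psi) =
  overlap (app_op (adj U1) a1) (app_op (adj U2) a2) (app_op (adj U3) a3) psi.
Proof.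
rewrite /overlap /local_op /app_op !sum2 !adjE !rmorphD !rmorphM /= !conjCK.
ring.
Qed.

Definition sq3 psi : C := \sum_(i < 2) \sum_(j < 2) \sum_(k < 2) `|psi i j k| ^+ 2.

(** The unitaries act one tensor factor at a time: [f1] and [f2] are the intermediate states, and
    each step preserves the squared norm of every fibre along its own index. *)
Lemma sq3_local_op U1 U2 U3 psi :
  unitary2 U1 -> unitary2 U2 -> unitary2 U3 ->
  sq3 (local_op U1 U2 U3 psi) = sq3 psi.
Proof.
move=> u1 u2 u3.
pose f1 := fun i j k => app_op U3 (psi i j) k.
pose f2 := fun i j k => app_op U2 (fun j => f1 i j k) j.
have -> : sq3 (local_op U1 U2 U3 psi) =
   \sum_(j < 2) \sum_(k < 2) qsq (app_op U1 (fun i => f2 i j k)).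
  have e i j k : local_op U1 U2 U3 psi i j k = app_op U1 (fun i => f2 i j k) i.
    by rewrite /local_op /app_op /f2 /f1 /app_op !sum2; ring.
  by rewrite /sq3 /qsq !sum2 !e; ring.
transitivity (\sum_(j < 2) \sum_(k < 2) qsq (fun i => f2 i j k)).
  by do 2!apply: eq_bigr => ? _; rewrite unitary2_qsq.
transitivity (\sum_(i < 2) \sum_(k < 2) qsq (fun j => f1 i j k)).
  transitivity (\sum_(i < 2) \sum_(k < 2) qsq (fun j => f2 i j k)).
    by rewrite !sum2 /qsq; ring.
  by do 2!apply: eq_bigr => ? _; rewrite unitary2_qsq.
transitivity (\sum_(i < 2) \sum_(j < 2) qsq (psi i j)).
  transitivity (\sum_(i < 2) \sum_(j < 2) qsq (f1 i j)).
    by rewrite !sum2 /qsq; ring.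
  by do 2!apply: eq_bigr => ? _; rewrite unitary2_qsq.
by rewrite /sq3 !sum2.
Qed.

(** Local unitaries pass to the product vector as adjoints, which map normalized product states onto
    normalized product states; the phase [c] disappears in the modulus. *)
Lemma is_G_local_op U1 U2 U3 c phi psi g :
  unitary2 U1 -> unitary2 U2 -> unitary2 U3 -> `|c| = 1 ->
  (forall i j k, phi i j k = c * local_op U1 U2 U3 psi i j k) ->
  is_G psi g -> is_G phi g.
Proof.
move=> u1 u2 u3 nc ephi [ub [a1 [a2 [a3 [n1 n2 n3 h]]]]].
have oE b1 b2 b3 : `|overlap b1 b2 b3 phi| =
   `|overlap (app_op (adj U1) b1) (app_op (adj U2) b2) (app_op (adj U3) b3) psi|.
  rewrite -overlap_local_op -[RHS]mul1r -nc -normrM; congr (`|_|).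
  by rewrite /overlap !sum2 !ephi; ring.
have un U a : unitary2 U -> qnormalized a -> qnormalized (app_op U a).
  by move=> uU /qnormE na; apply/qnormE; rewrite unitary2_qsq.
have va := unitary2_adj.
split=> [b1 b2 b3 m1 m2 m3|]; first by rewrite oE; apply: ub; apply: un; auto.
exists (app_op U1 a1), (app_op U2 a2), (app_op U3 a3); split; try exact: un.
have cancel U a i : unitary2 U -> app_op (adj U) (app_op U a) i = a i.
  move=> /unitary2C/matrixP/(_ i) Uu.
  have := Uu 0; have := Uu 1; rewrite !mxE !sum2 => h1 h0.
  transitivity ((adj U i 0 * U 0 0 + adj U i 1 * U 1 0) * a 0
     + (adj U i 0 * U 0 1 + adj U i 1 * U 1 1) * a 1); first by rewrite /app_op; ring.
  by rewrite h0 h1; case: (ord2P i) => -> /=; rewrite !(mul0r,mul1r,addr0,add0r).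
rewrite oE -h /overlap !sum2.
by rewrite !(cancel U1) ?(cancel U2) ?(cancel U3).
Qed.

Lemma is_G_uniq psi g h : is_G psi g -> is_G psi h -> g = h.
Proof.
move=> [ubg [a1 [a2 [a3 [n1 n2 n3 eg]]]]] [ubh [b1 [b2 [b3 [m1 m2 m3 eh]]]]].
by apply/le_anti/andP; split; [rewrite -eg ubh|rewrite -eh ubg].
Qed.

End LocalOperations.

(** * The W state *)

Section WState.
Variable C : numClosedFieldType.
Implicit Types (U V : 'M[C]_2) (psi phi : state3 C) (a : qubit C).

Lemma W_bound (x0 x1 y0 y1 z0 z1 : C) :
  0 <= x0 -> 0 <= x1 -> 0 <= y0 -> 0 <= y1 -> 0 <= z0 -> 0 <= z1 ->
  x0 ^+ 2 + x1 ^+ 2 = 1 -> y0 ^+ 2 + y1 ^+ 2 = 1 -> z0 ^+ 2 + z1 ^+ 2 = 1 ->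
  (x1 * y0 * z0 + x0 * y1 * z0 + x0 * y0 * z1) ^+ 2 <= 4 / 3.
Proof.
move=> /ger0_real rx0 /ger0_real rx1 /ger0_real ry0 /ger0_real ry1 /ger0_real rz0 /ger0_real rz1 nx ny nz.
have [ex ey ez] : [/\ x1 ^+ 2 = 1 - x0 ^+ 2, y0 ^+ 2 = 1 - y1 ^+ 2 & z1 ^+ 2 = 1 - z0 ^+ 2].
  by split; [rewrite -nx|rewrite -ny|rewrite -nz]; ring.
rewrite -subr_ge0.
(* Sum-of-squares certificate. The first square is the Cauchy-Schwarz defect in (z0, z1); the other
   two complete the square of what is left as a quadratic form in (y0, y1). *)
have -> : 4 / 3 - (x1 * y0 * z0 + x0 * y1 * z0 + x0 * y0 * z1) ^+ 2 =
  (z0 * (x0 * y0) - z1 * (x1 * y0 + x0 * y1)) ^+ 2 +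
  (3^-1 * (y0 - 3 * x0 * x1 * y1) ^+ 2 + 3 * ((x0 ^+ 2 - 2 / 3) * y1) ^+ 2).
  by field: ex ey ez.
have sq (t : C) : t \is Num.real -> 0 <= t ^+ 2 by move=> rt; rewrite real_exprn_even_ge0.
apply: addr_ge0; last apply: addr_ge0;
  last by rewrite mulr_ge0 ?sq // !(rpredB, rpredM, rpredX, rpredV, realn).
  by rewrite sq // !(rpredB, rpredM, rpredD).
by rewrite mulr_ge0 ?invr_ge0 ?sq // !(rpredB, rpredM, realn).
Qed.

Lemma sq_sqrtC3 : (sqrtC 3 : C)^-1 ^+ 2 = 3^-1.
Proof. by rewrite exprVn sqrtCK. Qed.

Lemma normsq_W : `|(sqrtC 3 : C)^-1| ^+ 2 = 3^-1.
Proof. by rewrite ger0_norm ?sq_sqrtC3 // invr_ge0 sqrtC_ge0. Qed.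

Lemma W_normalized : normalized3 (@Wstate C).
Proof.
rewrite /normalized3 /Wstate !sum2 /= normsq_W normr0.
by field.
Qed.

Lemma overlap_W a1 a2 a3 : overlap a1 a2 a3 (@Wstate C) =
  (sqrtC 3)^-1 * ((a1 1)^* * (a2 0)^* * (a3 0)^* + (a1 0)^* * (a2 1)^* * (a3 0)^*
   + (a1 0)^* * (a2 0)^* * (a3 1)^*).
Proof. by rewrite /overlap /Wstate !sum2 /=; ring. Qed.

Lemma W_G : is_G (@Wstate C) (2 / 3).
Proof.
split=> [a1 a2 a3 /qnormE n1 /qnormE n2 /qnormE n3|].
  rewrite -(@ler_pXn2r _ 2) ?nnegrE ?divr_ge0 ?ler0n //.
  rewrite overlap_W normrM exprMn normsq_W mulrC ler_pdivrMr ?ltr0n //.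
  have -> : (2 / 3 : C) ^+ 2 * 3 = 4 / 3 by field.
  apply: le_trans (W_bound _ _ _ _ _ _ n1 n2 n3) => //.
  rewrite ler_pXn2r ?nnegrE ?addr_ge0 ?mulr_ge0 ?normr_ge0 //.
  apply: le_trans (ler_normD _ _) _; rewrite lerD //.
    by apply: le_trans (ler_normD _ _) _; rewrite !normrM !norm_conjC.
  by rewrite !normrM !norm_conjC.
pose r : C := (sqrtC 3)^-1.
have r2 : r ^+ 2 = 3^-1 by exact: sq_sqrtC3.
have rc : r^* = r by apply: geC0_conj; rewrite invr_ge0 sqrtC_ge0.
pose s : C := sqrtC 2.
have s2 : s ^+ 2 = 2 by rewrite sqrtCK.
have sc : s^* = s by apply: geC0_conj; rewrite sqrtC_ge0.
(* The amplitudes sqrt (2/3) and sqrt (1/3), used for all three qubits, make all the squares in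
   [W_bound] vanish. *)
pose a : qubit C := fun i => if i == 0 then s * r else r.
have na : qnormalized a.
  apply/qnormE; rewrite /qsq /a /= !normCK rmorphM /= sc rc.
  transitivity ((s ^+ 2 + 1) * r ^+ 2); first by ring.
  by rewrite s2 r2; field.
exists a, a, a; split => //.
rewrite overlap_W -/r /a /= rmorphM /= sc rc.
have -> : r * (r * (s * r) * (s * r) + s * r * r * (s * r) + s * r * (s * r) * r) =
  3 * s ^+ 2 * (r ^+ 2) ^+ 2 by ring.
rewrite s2 r2 -[RHS]ger0_norm ?divr_ge0 //; congr (`|_|); by field.
Qed.

End WState.

(** * Real inequalities *)

Section RealInequalities.
Variable C : numClosedFieldType.
Implicit Types (a b c p q r x y : C).

Lemma sqr_real_ge0 x : x \is Num.real -> 0 <= x ^+ 2.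
Proof. by move=> rx; rewrite real_exprn_even_ge0. Qed.

Lemma sqr_real_gt0 x : x \is Num.real -> x != 0 -> 0 < x ^+ 2.
Proof. by move=> rx x0; rewrite lt0r expf_neq0 ?sqr_real_ge0. Qed.

(** The points with t = 0 are excluded because the form arises below after division by t^2. Each
    conclusion therefore comes from explicit test points with nonzero t. *)
Lemma quad_form q l r :
  q \is Num.real -> l \is Num.real -> r \is Num.real ->
  (forall s t, s \is Num.real -> t \is Num.real -> t != 0 ->
     0 <= q * s ^+ 2 - 2 * l * s * t + r * t ^+ 2) ->
  [/\ 0 <= q, 0 <= r & l ^+ 2 <= q * r].
Proof.
move=> rq rl rr H.
have r0 : 0 <= r.
  have := H 0 1 (real0 _) (real1 _) (oner_neq0 _).
  by rewrite expr0n expr1n !mulr0 mul0r subr0 add0r mulr1.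
have q0 : 0 <= q.
  case: (real_leP (real0 _) rq) => // q0.
  have m0 : 0 < - q by rewrite oppr_gt0.
  have rs : r + 1 - q \is Num.real by rewrite !(rpredB, rpredD, real1).
  have rm : - q \is Num.real by rewrite rpredN.
  (* Adding the values at (r + 1 - q, q) and (r + 1 - q, -q) cancels the cross term; for q < 0 the
     sum is negative. *)
  have := addr_ge0 (H _ _ rs rq (ltr0_neq0 q0)) (H _ _ rs rm (lt0r_neq0 m0)).
  set z := (X in 0 <= X -> _).
  suff : 0 < - z by rewrite oppr_gt0 => /lt_le_trans h /h; rewrite ltxx.
  have -> : - z = 2 * (- q) *
    (1 + (r ^+ 2 + (- q) ^+ 2 + 2 * r + 2 * (- q) + r * (- q))) by rewrite /z; ring.
  have m0' := ltW m0.
  by rewrite !mulr_gt0 // ltr_pwDl // !addr_ge0 // ?mulr_ge0 ?exprn_ge0.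
split => //.
have [qz|qn] := eqVneq q 0.
  have [->|ln] := eqVneq l 0; first by rewrite expr0n mulr_ge0.
  have r1 : r + 1 \is Num.real by rewrite rpredD ?real1.
  have l2 : 2 * l \is Num.real by rewrite rpredM ?realn.
  (* With q = 0, the point (r + 1, 2 l) gives the form the negative value - 4 l^2. *)
  have := H _ _ r1 l2 (mulf_neq0 (lt0r_neq0 (ltr0n C 2)) ln).
  rewrite qz (_ : _ + _ = - (4 * l ^+ 2)); last by ring.
  rewrite oppr_ge0 pmulr_rle0 ?ltr0n // => h.
  by rewrite mul0r.
have := H _ _ rl rq qn.
have -> : q * l ^+ 2 - 2 * l * l * q + r * q ^+ 2 = q * (q * r - l ^+ 2) by ring.
by rewrite pmulr_rge0 ?subr_ge0 // lt0r qn.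
Qed.

(** For q, P > 0, optimising over (w1, w2) turns the hypothesis into (m x)^2 / q + (n y)^2 / r <= P
    - x^2 - y^2. Substituting m^2 = P - q and n^2 = P - r gives x^2 / q + y^2 / r <= 1, an ellipse
    contained in the disc of squared radius r since q <= r. *)
Lemma disc_bound m n x y q r P :
  m \is Num.real -> n \is Num.real -> x \is Num.real -> y \is Num.real ->
  0 <= q -> q <= r -> m ^+ 2 = P - q -> n ^+ 2 = P - r ->
  0 <= P - x ^+ 2 - y ^+ 2 ->
  (forall w1 w2, w1 \is Num.real -> w2 \is Num.real ->
    (m * x * w1 + n * y * w2) ^+ 2 <=
      (q * w1 ^+ 2 + r * w2 ^+ 2) * (P - x ^+ 2 - y ^+ 2)) ->
  x ^+ 2 + y ^+ 2 <= r /\ (0 < P -> q = 0 -> x = 0).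
Proof.
move=> rm rn rx ry q0 qr em en R0 H.
have r0 := le_trans q0 qr.
have [X0 Y0] := (sqr_real_ge0 rx, sqr_real_ge0 ry).
have [M0 N0] := (sqr_real_ge0 rm, sqr_real_ge0 rn).
have P0 : 0 <= P by rewrite -(subrK q P) -em addr_ge0.
have [PE|Pn] := eqVneq P 0.
  split; last by rewrite PE ltxx.
  apply: le_trans r0; rewrite -oppr_ge0.
  by move: R0; rewrite PE sub0r opprD.
have Pp : 0 < P by rewrite lt0r Pn.
(* The two coordinate directions settle the degenerate case q = 0. *)
have h1 : P * x ^+ 2 <= q * (P - y ^+ 2).
  have := H 1 0 (real1 _) (real0 _); rewrite -subr_ge0 => h; rewrite -subr_ge0.
  by rewrite (_ : q * _ - _ = (q * 1 ^+ 2 + r * 0 ^+ 2) * (P - x ^+ 2 - y ^+ 2) -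
     (m * x * 1 + n * y * 0) ^+ 2) //; ring: em.
have h2 : P * y ^+ 2 <= r * (P - x ^+ 2).
  have := H 0 1 (real0 _) (real1 _); rewrite -subr_ge0 => h; rewrite -subr_ge0.
  by rewrite (_ : r * _ - _ = (q * 0 ^+ 2 + r * 1 ^+ 2) * (P - x ^+ 2 - y ^+ 2) -
     (m * x * 0 + n * y * 1) ^+ 2) //; ring: en.
have x00 : q = 0 -> x = 0.
  move=> qE; move: h1; rewrite qE mul0r pmulr_rle0 // => h1.
  by apply/eqP; rewrite -sqrf_eq0 eq_le h1.
split=> //.
have [qE|qn] := eqVneq q 0.
  move: h2; rewrite x00 // expr0n subr0 add0r mulrC.
  by rewrite ler_pM2r.
have qp : 0 < q by rewrite lt0r qn.
have rp := lt_le_trans qp qr.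
(* [W] is the left-hand form at the direction (m x r, n y q), the one for which
   Cauchy-Schwarz is sharp. *)
pose W := m ^+ 2 * x ^+ 2 * r + n ^+ 2 * y ^+ 2 * q.
have W0 : 0 <= W by rewrite /W addr_ge0 // mulr_ge0 // mulr_ge0.
have WR : W <= q * r * (P - x ^+ 2 - y ^+ 2).
  have [->|Wn] := eqVneq W 0; first by rewrite mulr_ge0 ?mulr_ge0.
  have rq := ger0_real q0; have rr := ger0_real r0.
  have := H (m * x * r) (n * y * q) _ _.
  rewrite !rpredM // => /(_ isT isT).
  have -> : m * x * (m * x * r) + n * y * (n * y * q) = W by rewrite /W; ring.
  have -> : (q * (m * x * r) ^+ 2 + r * (n * y * q) ^+ 2) * (P - x ^+ 2 - y ^+ 2)
    = (q * r * (P - x ^+ 2 - y ^+ 2)) * W by rewrite /W; ring.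
  by rewrite expr2 ler_pM2r // lt0r Wn.
have : P * (x ^+ 2 * r + y ^+ 2 * q) <= P * (q * r).
  rewrite -subr_ge0 (_ : _ - _ = q * r * (P - x ^+ 2 - y ^+ 2) - W) ?subr_ge0 //.
  by rewrite /W; ring: em en.
rewrite ler_pM2l // => h3.
rewrite -(ler_pM2l qp); apply: le_trans h3.
by rewrite mulrDr lerD // mulrC // ler_wpM2l.
Qed.

(** AM-GM gives 27 p^2 <= (a + b + c)^3 <= (1 - 2 p)^3, and (1 - 2 p)^3 - 27 p^2 factors as (1 - 8
    p) (p + 1)^2. Equality in AM-GM forces a = b = c. *)
Lemma amgm3 a b c p : 0 <= a -> 0 <= b -> 0 <= c -> 0 <= p -> p ^+ 2 = a * b * c ->
  a + b + c + 2 * p <= 1 ->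
  8 * p <= 1 /\ (8 * p = 1 -> [/\ a = 4^-1, b = 4^-1 & c = 4^-1]).
Proof.
move=> a0 b0 c0 p0 ep h.
pose s := a + b + c.
have s0 : 0 <= s by rewrite !addr_ge0.
have [ra rb rc] : [/\ a \is Num.real, b \is Num.real & c \is Num.real].
  by rewrite !ger0_real.
have rab := rpredB ra rb; have rbc := rpredB rb rc; have rca := rpredB rc ra.
(* [E] is twice the AM-GM gap s^3 - 27 a b c, written with visibly nonnegative terms. *)
pose E := s * ((a - b) ^+ 2 + (b - c) ^+ 2 + (c - a) ^+ 2)
   + 6 * (a * (b - c) ^+ 2 + b * (c - a) ^+ 2 + c * (a - b) ^+ 2).
have eE : s ^+ 3 * 2 = 54 * p ^+ 2 + E by rewrite ep /E /s; ring.
have F0 : 0 <= 6 * (a * (b - c) ^+ 2 + b * (c - a) ^+ 2 + c * (a - b) ^+ 2).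
  by rewrite mulr_ge0 ?ler0n // !addr_ge0 // mulr_ge0 // sqr_real_ge0.
have E0 : 0 <= E.
  by rewrite /E addr_ge0 // mulr_ge0 // !addr_ge0 // sqr_real_ge0.
have hs : s <= 1 - 2 * p by rewrite lerBrDr.
have h12 : 0 <= 1 - 2 * p := le_trans s0 hs.
have hs3 : s ^+ 3 <= (1 - 2 * p) ^+ 3 by rewrite lerXn2r.
have p8 : 8 * p <= 1.
  have : 0 <= (1 - 8 * p) * (p + 1) ^+ 2.
    rewrite (_ : _ * _ = (1 - 2 * p) ^+ 3 - 27 * p ^+ 2); last by ring.
    rewrite subr_ge0; apply: le_trans hs3.
    rewrite -(ler_pM2r (ltr0n _ 2)) eE -subr_ge0.
    by rewrite (_ : _ - _ = E) //; ring.
  rewrite pmulr_lge0 ?subr_ge0 // exprn_gt0 //.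
  by rewrite ltr_wpDl ?ltr01.
split=> // ep8.
have pE : p = 8^-1 by apply: (mulfI (lt0r_neq0 (ltr0n C 8))); rewrite ep8; field.
have sle : s <= 3 / 4 by apply: le_trans hs _; rewrite pE le_eqVlt; apply/orP; left; apply/eqP; field.
have Ele : E <= 0.
  have -> : E = 2 * (s ^+ 3 - (3 / 4) ^+ 3).
    by transitivity (s ^+ 3 * 2 - 54 * p ^+ 2); [rewrite eE; ring|rewrite pE; field].
  by rewrite pmulr_rle0 ?ltr0n // subr_le0 lerXn2r ?nnegrE ?divr_ge0 ?ler0n.
have Ez : E = 0 by apply/le_anti; rewrite Ele.
have sn : s != 0.
  apply: contraTneq (lt0r_neq0 (ltr0n C 54)) => sz; rewrite negbK.
  have := eE; rewrite Ez sz pE addr0 expr0n mul0r => /eqP.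
  by rewrite eq_sym mulf_eq0 expf_eq0 invr_eq0 [(8 : C) == 0]pnatr_eq0 /= orbF.
have sp : 0 < s by rewrite lt0r sn.
have dz : (a - b) ^+ 2 + (b - c) ^+ 2 + (c - a) ^+ 2 = 0.
  apply/eqP; rewrite eq_le; apply/andP; split; last by rewrite !addr_ge0 // sqr_real_ge0.
  by rewrite -(pmulr_rle0 _ sp); apply: le_trans Ele; rewrite /E lerDl.
have ab : a = b.
  apply/eqP; rewrite -subr_eq0 -sqrf_eq0 eq_le sqr_real_ge0 // andbT -dz.
  by rewrite -addrA lerDl addr_ge0 // sqr_real_ge0.
have bc : b = c.
  apply/eqP; rewrite -subr_eq0 -sqrf_eq0 eq_le sqr_real_ge0 // andbT -dz ab subrr expr0n add0r.
  by rewrite lerDl sqr_real_ge0 ?rpredB.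
have cE : c = 4^-1.
  have c3 : (4 * c) ^+ 3 = 1 ^+ 3.
    have -> : (4 * c) ^+ 3 = 64 * p ^+ 2 by rewrite ep ab bc; ring.
    by rewrite pE; field.
  have /pexpIrn : (0 < 3)%N by [].
  move=> /(_ C (4 * c) 1); rewrite !nnegrE mulr_ge0 ?ler0n // ler01 => /(_ isT isT c3) e.
  by apply: (mulfI (lt0r_neq0 (ltr0n C 4))); rewrite e; field.
by rewrite ab bc cE.
Qed.

End RealInequalities.

(** * The determinant form and its polar expansion *)

Section DetForm.
Variable C : numClosedFieldType.
Implicit Types (z : C).

(** The phase is produced as a square because [detform_polar] needs half-phases. *)
Lemma polar_sqrt z : exists2 e : C, `|e| = 1 & z = `|z| * e ^+ 2.
Proof.
have [->|zn] := eqVneq z 0; first by exists 1; rewrite ?normr1 ?normr0 ?mul0r.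
have nz : `|z| != 0 by rewrite normr_eq0.
exists (sqrtC (z / `|z|)); last by rewrite sqrtCK mulrC divfK.
by apply/eqP; rewrite -sqrp_eq1 // -normrX sqrtCK normrM normfV normr_id divff.
Qed.

(** This is det (N - M M^H), where N = |x0|^2 + |x1|^2 and M has rows (x0, x1 be) and (x1 ga, x0 al
    + x1 de): the contraction of the canonical state, divided by g, with (x0, x1). *)
Definition detform (al be ga de x0 x1 : C) : C :=
  (`|x0| ^+ 2 + `|x1| ^+ 2) ^+ 2
  - (`|x0| ^+ 2 + `|x1| ^+ 2) *
    (`|x0| ^+ 2 + `|x1| ^+ 2 * (`|be| ^+ 2 + `|ga| ^+ 2) + `|x0 * al + x1 * de| ^+ 2)
  + `|x0 * (x0 * al + x1 * de) - x1 ^+ 2 * (be * ga)| ^+ 2.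

(** With x0 = s real and this phase of x1, the three terms of det M share the phase e1^2, so only
    the real parameters remain. The coefficients of s^4 and s^3 t cancel, hence the factor t^2 and a
    quadratic form in (s, t). *)
Lemma detform_polar (al be ga de A B e1 e2 x y s t w1 w2 : C) :
  `|e1| = 1 -> `|e2| = 1 -> al = A * e1 ^+ 2 -> be * ga = B * e2 ^+ 2 ->
  `|be| ^+ 2 * `|ga| ^+ 2 = B ^+ 2 ->
  A \is Num.real -> B \is Num.real -> x \is Num.real -> y \is Num.real ->
  s \is Num.real -> t \is Num.real -> w1 \is Num.real -> w2 \is Num.real ->
  de = e1 * e2 * (x + 'i * y) ->
  let S := `|al| ^+ 2 + `|be| ^+ 2 + `|ga| ^+ 2 in
  let n := w1 ^+ 2 + w2 ^+ 2 in
  let P := (1 - `|be| ^+ 2) * (1 - `|ga| ^+ 2) in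
  detform al be ga de s (e1 * e2^* * (w1 + 'i * w2) * t) =
  t ^+ 2 * (((1 - S - 2 * A * B) * w1 ^+ 2 + (1 - S + 2 * A * B) * w2 ^+ 2) * s ^+ 2
    - 2 * (n * ((A + B) * x * w1 + (B - A) * y * w2)) * s * t
    + (n ^+ 2 * (P - x ^+ 2 - y ^+ 2)) * t ^+ 2).
Proof.
move=> n1 n2 eal ebg eB /CrealP cA /CrealP cB /CrealP cx /CrealP cy.
move=> /CrealP cs /CrealP ct /CrealP cw1 /CrealP cw2 ede /=.
have c1 : e1 * e1^* = 1 by rewrite -normCK n1 expr1n.
have c2 : e2 * e2^* = 1 by rewrite -normCK n2 expr1n.
rewrite /detform ebg.
move: (`|be| ^+ 2) (`|ga| ^+ 2) eB => b c eB.
rewrite !normCK eal ede.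
rewrite !(rmorphB, rmorphD, rmorphM, rmorphXn) /= conjCi conjCK cA cB cx cy cs ct cw1 cw2.
move: ('i) (sqrCi C) (e1^*) (e2^*) c1 c2 => i i2 f1 f2 c1 c2.
ring: i2 c1 c2 eB.
Qed.

End DetForm.

(** * Inequalities for the canonical coefficients *)

Section Bounds.
Variable C : numClosedFieldType.
Implicit Types (z : C).

(** Here q = 1 - S - 2 p and r = 1 - S + 2 p, and P - q, P - r are the squares of A + B and B - A,
    as [disc_bound] requires. When q = 0 the component x vanishes, so de is i y times the
    half-phases and de^2 has the phase opposite to al be ga: the third claim. *)
Lemma detform_bound (al be ga de : C) :
  (forall x0 x1, 0 <= detform al be ga de x0 x1) ->
  let S := `|al| ^+ 2 + `|be| ^+ 2 + `|ga| ^+ 2 in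
  let p := `|al * be * ga| in
  [/\ S + `|de| ^+ 2 <= 1 + 2 * p, S + 2 * p <= 1 &
      0 < (1 - `|be| ^+ 2) * (1 - `|ga| ^+ 2) -> S + 2 * p = 1 ->
      de ^+ 2 * p = - (`|de| ^+ 2 * (al * be * ga))].
Proof.
move=> H S p.
have [e1 n1 eal] := polar_sqrt al.
have [e2 n2 ebg] := polar_sqrt (be * ga).
pose A := `|al|; pose B := `|be * ga|.
have pE : p = A * B by rewrite /p -mulrA normrM.
have c1 : e1 * e1^* = 1 by rewrite -normCK n1 expr1n.
have c2 : e2 * e2^* = 1 by rewrite -normCK n2 expr1n.
(* Cartesian coordinates of [de] relative to the phase e1 e2, half the phase of al be ga. *)
have [x [y [rx ry ede]]] : exists x y, [/\ x \is Num.real, y \is Num.real & de = e1 * e2 * (x + 'i * y)].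
  exists ('Re (de * e1^* * e2^*)), ('Im (de * e1^* * e2^*)).
  by rewrite Creal_Re Creal_Im -Crect; split=> //; ring: c1 c2.
have D2 : `|de| ^+ 2 = x ^+ 2 + y ^+ 2.
  by rewrite ede !normrM n1 n2 !mul1r normC2_rect.
pose P := (1 - `|be| ^+ 2) * (1 - `|ga| ^+ 2).
have [rA rB] : A \is Num.real /\ B \is Num.real by rewrite !normr_real.
have eB : `|be| ^+ 2 * `|ga| ^+ 2 = B ^+ 2 by rewrite /B normrM exprMn.
have rsq z : `|z| ^+ 2 \is Num.real by rewrite rpredX // normr_real.
have rS : S \is Num.real by rewrite !rpredD.
have rP : P \is Num.real by rewrite rpredM // rpredB ?real1.
have rAB : 2 * A * B \is Num.real by rewrite !rpredM ?realn.
have [[q qE] [r rE]] : {q | q = 1 - S - 2 * A * B} * {r | r = 1 - S + 2 * A * B}.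
  by split; eexists.
have [rq rr] : q \is Num.real /\ r \is Num.real by rewrite qE rE !(rpredB, rpredD, real1).
have rR : P - x ^+ 2 - y ^+ 2 \is Num.real by rewrite !rpredB ?rpredX.
have K w1 w2 : w1 \is Num.real -> w2 \is Num.real ->
   let n := w1 ^+ 2 + w2 ^+ 2 in
   [/\ 0 <= q * w1 ^+ 2 + r * w2 ^+ 2, 0 <= n ^+ 2 * (P - x ^+ 2 - y ^+ 2) &
    (n * ((A + B) * x * w1 + (B - A) * y * w2)) ^+ 2 <=
      (q * w1 ^+ 2 + r * w2 ^+ 2) * (n ^+ 2 * (P - x ^+ 2 - y ^+ 2))].
  move=> r1 r2 n.
  have rn : n \is Num.real by rewrite rpredD ?rpredX.
  apply: quad_form.
  - by rewrite rpredD // rpredM // rpredX.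
  - apply: rpredM => //; apply: rpredD; apply: rpredM => //; apply: rpredM => //.
    by rewrite rpredD.
    by rewrite rpredB.
  - by rewrite rpredM // rpredX.
  move=> s t rs rt t0.
  have := H s (e1 * e2^* * (w1 + 'i * w2) * t).
  rewrite (detform_polar n1 n2 eal ebg eB rA rB rx ry rs rt r1 r2 ede) -/S -qE -rE.
  by rewrite pmulr_rge0 // sqr_real_gt0.
have q0 : 0 <= q.
  have [+ _ _] := K 1 0 (real1 _) (real0 _).
  by rewrite expr1n expr0n mulr0 addr0 mulr1.
have R0 : 0 <= P - x ^+ 2 - y ^+ 2.
  have [_ + _] := K 1 0 (real1 _) (real0 _).
  by rewrite expr1n expr0n addr0 expr1n mul1r.
have qr : q <= r.
  rewrite -subr_ge0 (_ : _ - _ = 4 * (A * B)); last by rewrite rE qE; ring.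
  by rewrite !mulr_ge0 ?ler0n ?normr_ge0.
have [||||w1 w2 r1 r2|h1 h2] := @disc_bound C (A + B) (B - A) x y q r P _ _ rx ry q0 qr _ _ R0.
- by rewrite rpredD.
- by rewrite rpredB.
- by rewrite /P qE /S -/A; ring: eB.
- by rewrite /P rE /S -/A; ring: eB.
- have [n0|nn] := eqVneq (w1 ^+ 2 + w2 ^+ 2) 0.
    have [w10 w20] : w1 = 0 /\ w2 = 0.
      move/eqP: n0; rewrite paddr_eq0 ?sqr_real_ge0 // !sqrf_eq0.
      by move=> /andP[/eqP -> /eqP ->].
    by rewrite w10 w20 !mulr0 addr0 expr0n /= !mulr0 addr0 mul0r.
  have n2_gt0 : 0 < (w1 ^+ 2 + w2 ^+ 2) ^+ 2 by rewrite sqr_real_gt0 // rpredD ?rpredX.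
  have [_ _ h] := K w1 w2 r1 r2.
  by rewrite -(ler_pM2l n2_gt0) -exprMn mulrCA.
rewrite D2 pE; split.
- by rewrite addrC -lerBrDr (_ : _ - S = r) // rE; ring.
- rewrite -subr_ge0 (_ : 1 - _ = q) // qE; ring.
- move=> Pp e.
  have x0 : x = 0.
    by apply: h2 => //; rewrite qE -{1}e; ring.
  rewrite -mulrA ebg -/B {1}eal -/A ede x0 add0r expr0n add0r.
  have ii := sqrCi C.
  by ring: ii.
Qed.

Lemma herm2_det (m n k : C) : m \is Num.real -> n \is Num.real ->
  (forall y0 y1, 0 <= m * `|y0| ^+ 2 + n * `|y1| ^+ 2 - y0 * y1^* * k - y0^* * y1 * k^*) ->
  0 <= m * n - `|k| ^+ 2.
Proof.
move=> rm rn H.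
have m0 : 0 <= m.
  by have := H 1 0; rewrite normr1 normr0 conjC0 !expr1n !expr0n !(mulr0, mul0r) !(mulr1, subr0, addr0).
have n0 : 0 <= n.
  by have := H 0 1; rewrite normr1 normr0 conjC0 !expr1n !expr0n !(mulr0, mul0r) !(mulr1, subr0, add0r).
have [->|kn] := eqVneq k 0; first by rewrite normr0 expr0n subr0 mulr_ge0.
have K0 : 0 < `|k| ^+ 2 by rewrite exprn_gt0 // normr_gt0.
have rK : `|k| ^+ 2 \is Num.real by rewrite ger0_real // ltW.
have [||||_ _ ] := @quad_form C (m * `|k| ^+ 2) (`|k| ^+ 2) n => //.
- by rewrite rpredM.
- move=> s t /CrealP cs /CrealP ct _.
  (* Aligning the first coordinate with the conjugate of [k] makes the cross term real, which
     reduces the claim to [quad_form]. *)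
  have := H (s * k^*) t; rewrite !normCK !rmorphM /= conjCK cs ct.
  by rewrite (_ : _ - _ - _ = m * (k * k^*) * s ^+ 2 - 2 * (k * k^*) * s * t + n * t ^+ 2) //; ring.
- by rewrite subr_ge0 -(ler_pM2r K0) -expr2 mulrAC.
Qed.

(* The eigenvalues of c - M M^H are nonnegative, hence so is its determinant. *)
Lemma opnorm2_det (c m00 m01 m10 m11 : C) : c \is Num.real ->
  (forall y0 y1 z0 z1, `|y0 * m00 * z0 + y0 * m01 * z1 + y1 * m10 * z0 + y1 * m11 * z1| ^+ 2
     <= c * (`|y0| ^+ 2 + `|y1| ^+ 2) * (`|z0| ^+ 2 + `|z1| ^+ 2)) ->
  0 <= c ^+ 2 - c * (`|m00| ^+ 2 + `|m01| ^+ 2 + `|m10| ^+ 2 + `|m11| ^+ 2)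
       + `|m00 * m11 - m01 * m10| ^+ 2.
Proof.
move=> rc H.
have rsq z : `|z| ^+ 2 \is Num.real by rewrite rpredX // normr_real.
have := @herm2_det (c - `|m00| ^+ 2 - `|m01| ^+ 2) (c - `|m10| ^+ 2 - `|m11| ^+ 2)
  (m00 * m10^* + m01 * m11^*).
rewrite !rpredB // => /(_ isT isT) h.
have -> : c ^+ 2 - c * (`|m00| ^+ 2 + `|m01| ^+ 2 + `|m10| ^+ 2 + `|m11| ^+ 2)
       + `|m00 * m11 - m01 * m10| ^+ 2 = (c - `|m00| ^+ 2 - `|m01| ^+ 2) * (c - `|m10| ^+ 2 - `|m11| ^+ 2)
 - `|m00 * m10^* + m01 * m11^*| ^+ 2.
  by rewrite !normCK !(rmorphB, rmorphD, rmorphM) /= !conjCK; ring.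
apply: h => y0 y1.
pose v0 := y0 * m00 + y1 * m10; pose v1 := y0 * m01 + y1 * m11.
pose nv := `|v0| ^+ 2 + `|v1| ^+ 2.
have nv0 : 0 <= nv by rewrite addr_ge0 // exprn_ge0.
(* For fixed y, the conjugate of the row vector y M is the z making Cauchy-Schwarz sharp: the
   bilinear value becomes |y M|^2. *)
have := H y0 y1 v0^* v1^*.
rewrite (_ : _ + _ + _ + _ = nv); last by rewrite /nv !normCK /v0 /v1; ring.
rewrite !norm_conjC -/nv (ger0_norm nv0) => h.
have : nv <= c * (`|y0| ^+ 2 + `|y1| ^+ 2).
  have [nvE|nvn] := eqVneq nv 0; last by move: h; rewrite expr2 ler_pM2r // lt0r nvn.
  rewrite nvE mulr_ge0 ?addr_ge0 ?exprn_ge0 //.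
  (* This instance reads |m00|^2 <= c, hence 0 <= c. *)
  have := H 1 0 1 0; rewrite normr1 normr0 expr1n expr0n addr0 !mulr1.
  by apply: le_trans; rewrite exprn_ge0.
rewrite -subr_ge0 => /le_trans; apply; rewrite le_eqVlt; apply/orP; left; apply/eqP.
by rewrite /nv /v0 /v1 !normCK !(rmorphD, rmorphM) /= !conjCK; ring.
Qed.

End Bounds.

(** * Closest product state *)

Section ClosestProductState.
Variable C : numClosedFieldType.
Implicit Types (U V : 'M[C]_2) (psi phi : state3 C) (a x y z : qubit C) (g : C).

Definition qubit_of (u v : C) : qubit C := fun i => if i == 0 then u else v.

Lemma qsq_qubit_of u v : qsq (qubit_of u v) = `|u| ^+ 2 + `|v| ^+ 2.
Proof. by []. Qed.

Lemma qsq_ge0 a : 0 <= qsq a.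
Proof. by rewrite addr_ge0 // exprn_ge0. Qed.

Lemma qsq_eq0 a : qsq a = 0 -> forall i, a i = 0.
Proof.
move=> /eqP; rewrite paddr_eq0 ?exprn_ge0 // !sqrf_eq0 !normr_eq0.
by move=> /andP[/eqP a0 /eqP a1] i; case: (ord2P i) => ->.
Qed.

Lemma overlapZ (k l m : C) x y z psi :
  overlap (fun i => k * x i) (fun i => l * y i) (fun i => m * z i) psi =
  k^* * l^* * m^* * overlap x y z psi.
Proof. by rewrite /overlap !sum2 !rmorphM /=; ring. Qed.

Lemma overlap_le psi g x y z : is_G psi g ->
  `|overlap x y z psi| ^+ 2 <= g ^+ 2 * qsq x * qsq y * qsq z.
Proof.
move=> [ub [a1 [a2 [a3 [_ _ _ eg]]]]].
have g0 : 0 <= g by rewrite -eg.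
have normalize a : exists2 b, qnormalized b & a =1 (fun i => sqrtC (qsq a) * b i).
  have [a0|an] := eqVneq (qsq a) 0.
    (* The zero vector has no direction; any unit vector serves, scaled by 0. *)
    exists (qubit_of 1 0); first by apply/qnormE; rewrite qsq_qubit_of normr1 normr0 expr1n expr0n addr0.
    by move=> i; rewrite a0 sqrtC0 mul0r qsq_eq0.
  have sn : sqrtC (qsq a) != 0 by rewrite sqrtC_eq0.
  exists (fun i => (sqrtC (qsq a))^-1 * a i); last by move=> i; rewrite mulVKf.
  apply/qnormE; rewrite /qsq !normrM !exprMn -mulrDr -/(qsq a).
  by rewrite normfV exprVn ger0_norm ?sqrtC_ge0 ?qsq_ge0 // sqrtCK mulVf.
have [x' nx ex] := normalize x; have [y' ny ey] := normalize y; have [z' nz ez] := normalize z.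
have -> : overlap x y z psi =
    (sqrtC (qsq x))^* * (sqrtC (qsq y))^* * (sqrtC (qsq z))^* * overlap x' y' z' psi.
  by rewrite -overlapZ; do 3!(apply: eq_bigr => ? _); rewrite ex ey ez.
rewrite !normrM !norm_conjC !exprMn.
have nE a : `|sqrtC (qsq a)| ^+ 2 = qsq a by rewrite ger0_norm ?sqrtCK // sqrtC_ge0 qsq_ge0.
have K0 : 0 <= qsq x * qsq y * qsq z by rewrite !mulr_ge0 ?qsq_ge0.
rewrite !nE [X in X <= _]mulrC [X in _ <= X](_ : _ = g ^+ 2 * (qsq x * qsq y * qsq z)); last by ring.
apply: ler_wpM2r => //.
by rewrite lerXn2r ?nnegrE // ub.
Qed.

Lemma sq3E psi : sq3 psi =
  `|psi 0 0 0| ^+ 2 + `|psi 0 0 1| ^+ 2 + `|psi 0 1 0| ^+ 2 + `|psi 0 1 1| ^+ 2 +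
  `|psi 1 0 0| ^+ 2 + `|psi 1 0 1| ^+ 2 + `|psi 1 1 0| ^+ 2 + `|psi 1 1 1| ^+ 2.
Proof. by rewrite /sq3 !sum2; ring. Qed.

(** Each [F a] is a unitary whose first row is the conjugate of a maximiser, so the 000 coefficient
    of the rotated state is the maximal overlap; dividing by its phase [e] makes it equal to g. *)
Lemma max_frame psi g : normalized3 psi -> is_G psi g ->
  exists U1 U2 U3 (c : C) phi,
  [/\ unitary2 U1, unitary2 U2, unitary2 U3 & `|c| = 1] /\
  [/\ forall i j k, psi i j k = c * local_op U1 U2 U3 phi i j k,
      is_G phi g, normalized3 phi & phi 0 0 0 = g].
Proof.
move=> npsi Gpsi; have [_ [a1 [a2 [a3 [n1 n2 n3 eg]]]]] := Gpsi.
pose F a : 'M[C]_2 := \matrix_(i, j)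
  if i == 0 then (a j)^* else if j == 0 then - a 1 else a 0.
have uF a : qnormalized a -> unitary2 (F a).
  move=> /qnormE; rewrite /qsq !normCK => na; apply/matrixP => i j.
  rewrite !mxE !sum2 !mxE /=.
  case: (ord2P i) (ord2P j) => -> [] -> /=; rewrite ?rmorphN ?conjCK /= -?na; ring.
pose w := overlap a1 a2 a3 psi.
have g0 : 0 <= g by rewrite -eg.
have [e ne we] : exists2 e : C, `|e| = 1 & w = e * g.
  have [w0|wn] := eqVneq w 0.
    by exists 1; rewrite ?normr1 // mul1r -eg -/w w0 normr0.
  exists (w / g); first by rewrite normrM normfV (ger0_norm g0) -eg divff // normr_eq0.
  by rewrite divfK // -eg normr_eq0.
have en : e != 0 by rewrite -normr_eq0 ne oner_neq0.
pose phi : state3 C := fun i j k => e^-1 * local_op (F a1) (F a2) (F a3) psi i j k.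
have ne' : `|e^-1| = 1 by rewrite normfV ne invr1.
have [u1 u2 u3] := And3 (uF _ n1) (uF _ n2) (uF _ n3).
exists (adj (F a1)), (adj (F a2)), (adj (F a3)), e, phi; split.
  by split=> //; apply: unitary2_adj.
split.
- move=> i j k; rewrite local_opZ mulVKf // local_opM.
  by rewrite !unitary2C // local_op1.
- by apply: (is_G_local_op u1 u2 u3 ne' _ Gpsi).
- have := sq3_local_op psi u1 u2 u3; rewrite [sq3 psi]npsi => n.
  apply: etrans n; do 3!(apply: eq_bigr => ? _).
  by rewrite /phi normrM ne' mul1r.
- have wE : local_op (F a1) (F a2) (F a3) psi 0 0 0 = w.
    by rewrite /local_op /w /overlap !sum2 !mxE /=.
  by rewrite /phi wE we mulKf.
Qed.

(** * States whose closest product state is |000> *)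

Section Stationary.
Variables (phi : state3 C) (g : C).
Hypotheses (nphi : normalized3 phi) (Gphi : is_G phi g) (phi0 : phi 0 0 0 = g).

Lemma G_gt0 : 0 < g.
Proof.
have [_ [a1 [a2 [a3 [_ _ _ eg]]]]] := Gphi.
rewrite lt0r -{2}eg normr_ge0 andbT; apply/eqP => g0.
have : sq3 phi = 1 by [].
have z i j k : phi i j k = 0.
  pose d (i : 'I_2) : qubit C := fun j => (i == j)%:R.
  have := @overlap_le phi g (d i) (d j) (d k) Gphi.
  rewrite g0 expr0n !mul0r => h; apply/eqP; rewrite -normr_eq0 -sqrf_eq0 eq_le.
  rewrite exprn_ge0 // andbT; apply: le_trans h; rewrite le_eqVlt; apply/orP; left; apply/eqP.
  congr (`|_| ^+ 2); rewrite /overlap !sum2 /d.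
  case: (ord2P i) (ord2P j) (ord2P k) => -> [] -> [] -> /=;
  by rewrite ?conjC0 ?conjC1 !(mul0r, mulr0, mul1r, addr0, add0r).
by rewrite sq3E !z normr0 expr0n !addr0 => /esym/eqP; rewrite oner_eq0.
Qed.

(** The hypothesis is the overlap bound for the test vector (g, u), where u is the coefficient with
    a single 1 in that slot: the overlap is then the squared norm of the vector, which exceeds the
    bound unless u = 0. *)
Lemma eq0_of_overlap_le (u : C) :
  `|g ^+ 2 + `|u| ^+ 2| ^+ 2 <= g ^+ 2 * (g ^+ 2 + `|u| ^+ 2) -> u = 0.
Proof.
have g0 := ltW G_gt0.
set m := `|u| ^+ 2; have m0 : 0 <= m by rewrite exprn_ge0.
have G2 : 0 < g ^+ 2 by rewrite exprn_gt0 ?G_gt0.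
have S0 : 0 < g ^+ 2 + m by rewrite ltr_wpDr.
rewrite (ger0_norm (ltW S0)) expr2 ler_pM2r // gerDl => mle.
by apply/eqP; rewrite -normr_eq0 -sqrf_eq0 eq_le -/m mle.
Qed.

Lemma stationary : [/\ phi 1 0 0 = 0, phi 0 1 0 = 0 & phi 0 0 1 = 0].
Proof.
have gr : g^* = g by apply: geC0_conj; rewrite ltW ?G_gt0.
have ng : `|g| ^+ 2 = g ^+ 2 by rewrite ger0_norm // ltW ?G_gt0.
have n1 : `|1 : C| ^+ 2 + `|0 : C| ^+ 2 = 1 by rewrite normr1 normr0 expr1n expr0n addr0.
split; apply: eq0_of_overlap_le.
- have := @overlap_le phi g (qubit_of g (phi 1 0 0)) (qubit_of 1 0) (qubit_of 1 0) Gphi.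
  rewrite !qsq_qubit_of n1 ng !mulr1; congr (`|_| ^+ 2 <= _).
  by rewrite /overlap !sum2 /qubit_of /= conjC0 conjC1 gr phi0 normCK; ring.
- have := @overlap_le phi g (qubit_of 1 0) (qubit_of g (phi 0 1 0)) (qubit_of 1 0) Gphi.
  rewrite !qsq_qubit_of n1 ng !mulr1; congr (`|_| ^+ 2 <= _).
  by rewrite /overlap !sum2 /qubit_of /= conjC0 conjC1 gr phi0 normCK; ring.
- have := @overlap_le phi g (qubit_of 1 0) (qubit_of 1 0) (qubit_of g (phi 0 0 1)) Gphi.
  rewrite !qsq_qubit_of n1 ng !mulr1; congr (`|_| ^+ 2 <= _).
  by rewrite /overlap !sum2 /qubit_of /= conjC0 conjC1 gr phi0 normCK; ring.
Qed.

Lemma detform_ge0 (x0 x1 : C) :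
  0 <= detform (phi 0 1 1 / g) (phi 1 0 1 / g) (phi 1 1 0 / g) (phi 1 1 1 / g) x0 x1.
Proof.
have [z1 z2 z3] := stationary.
have gn : g != 0 by rewrite gt_eqF ?G_gt0.
have gr : g^* = g by apply: geC0_conj; rewrite ltW ?G_gt0.
have N0 : 0 <= g ^+ 2 * (`|x0| ^+ 2 + `|x1| ^+ 2).
  by rewrite mulr_ge0 ?addr_ge0 ?exprn_ge0 // ltW ?G_gt0.
(* The matrix is the contraction of [phi] with (x0, x1), and its squared operator norm is at most
   g^2 N. Test vectors are conjugated since [overlap] conjugates its arguments. *)
have := @opnorm2_det C _ (x0 * g) (x1 * phi 1 0 1) (x1 * phi 1 1 0)
  (x0 * phi 0 1 1 + x1 * phi 1 1 1) (ger0_real N0) _.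
rewrite (_ : _ - _ + _ =
  g ^+ 4 * detform (phi 0 1 1 / g) (phi 1 0 1 / g) (phi 1 1 0 / g) (phi 1 1 1 / g) x0 x1).
  rewrite pmulr_rge0 ?exprn_gt0 ?G_gt0 //; apply=> y0 y1 w0 w1.
  have := @overlap_le phi g (qubit_of x0^* x1^*) (qubit_of y0^* y1^*) (qubit_of w0^* w1^*) Gphi.
  rewrite !qsq_qubit_of !norm_conjC -mulrA; congr (`|_| ^+ 2 <= _).
    by rewrite /overlap !sum2 /qubit_of /= !conjCK z1 z2 z3 phi0; ring.
rewrite /detform !normCK !(rmorphB, rmorphD, rmorphM, rmorphXn, fmorphV) /= gr.
by field.
Qed.

Lemma G_lower_bound : 4 / 9 <= g ^+ 2 /\
  (g ^+ 2 = 4 / 9 -> [/\ `|3 * phi 0 1 1| = 1, `|3 * phi 1 0 1| = 1, `|3 * phi 1 1 0| = 1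
    & phi 1 1 1 ^+ 2 = - (6 * phi 0 1 1 * phi 1 0 1 * phi 1 1 0)]).
Proof.
have gp := G_gt0; have gn : g != 0 by rewrite gt_eqF.
have [z1 z2 z3] := stationary.
have G2 : 0 < g ^+ 2 by rewrite exprn_gt0.
have scale (t : C) : exists t', t = g * t' by exists (t / g); rewrite mulrC divfK.
have [al ea] := scale (phi 0 1 1); have [be eb] := scale (phi 1 0 1).
have [ga ec] := scale (phi 1 1 0); have [de ed] := scale (phi 1 1 1).
have D (x0 x1 : C) : 0 <= detform al be ga de x0 x1.
  by have := detform_ge0 x0 x1; rewrite ea eb ec ed !(mulrC g) !mulfK.
have /= [] := detform_bound D.
set S := _ + _ + `|ga| ^+ 2; set p := `|al * be * ga| => SD Sp E.
have N : g ^+ 2 * (1 + S + `|de| ^+ 2) = 1.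
  have : sq3 phi = 1 by [].
  rewrite sq3E phi0 z1 z2 z3 ea eb ec ed !normrM (ger0_norm (ltW gp)) normr0 => h.
  by rewrite -[RHS]h /S; ring.
have p2 : p ^+ 2 = `|al| ^+ 2 * `|be| ^+ 2 * `|ga| ^+ 2 by rewrite /p !normrM !exprMn.
have sq (t : C) : 0 <= `|t| ^+ 2 by rewrite exprn_ge0.
have [p8 peq] := amgm3 (sq al) (sq be) (sq ga) (normr_ge0 _) p2 Sp.
have e9 : 9 = 8 + 1 :> C by ring.
(* With 8 p <= 1 the right side is at most 9, and [N] converts this into 4 / 9 <= g^2. Equality
   therefore forces 8 p = 1 and saturates every inequality used. *)
have T : 4 * (1 + S + `|de| ^+ 2) <= 8 + 8 * p.
  rewrite (_ : 8 + 8 * p = 4 * (1 + (1 + 2 * p))); last by ring.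
  by rewrite ler_pM2l ?ltr0n // -addrA lerD2l.
split.
  have h : 4 * (1 + S + `|de| ^+ 2) <= 9.
    by apply: le_trans T _; rewrite e9 lerD2l.
  rewrite ler_pdivrMr ?ltr0n //; move: h; rewrite -(ler_pM2l G2).
  by rewrite (mulrCA _ 4) N mulr1.
move=> g49.
have T9 : 4 * (1 + S + `|de| ^+ 2) = 9.
  have := N; rewrite g49 => /(congr1 (fun t => 9 * t)); rewrite mulr1 => <-.
  by field.
have p81 : 8 * p = 1.
  apply/le_anti; rewrite p8 /=; move: T; rewrite T9.
  by rewrite e9 lerD2l.
have [a4 b4 c4] := peq p81.
have pE : p = 8^-1 by apply: (mulfI (lt0r_neq0 (ltr0n C 8))); rewrite p81; field.
have SE : S = 3 / 4 by rewrite /S a4 b4 c4; field.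
have DE : `|de| ^+ 2 = 2^-1.
  apply: (mulfI (lt0r_neq0 (ltr0n C 4))); apply: (addrI (4 * (1 + S))).
  by rewrite -mulrDr T9 SE; field.
have ng (t : C) : `|t| ^+ 2 = 4^-1 -> `|3 * (g * t)| = 1.
  move=> t4; apply/eqP; rewrite -sqrp_eq1 // !normrM !exprMn t4 (ger0_norm (ltW gp)) g49 normr_nat.
  by apply/eqP; field.
rewrite ea eb ec ed; split; try exact: ng.
have P0 : 0 < (1 - `|be| ^+ 2) * (1 - `|ga| ^+ 2).
  rewrite b4 c4 (_ : _ * _ = 9 / 16); last by field.
  by rewrite divr_gt0 ?ltr0n.
have := E P0 _; rewrite SE pE DE (_ : 3 / 4 + 2 * 8^-1 = 1 :> C); last by field.
move=> /(_ erefl) eD.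
have {}eD : de ^+ 2 = - (4 * (al * be * ga)).
  apply: (mulIf (invr_neq0 (lt0r_neq0 (ltr0n C 8)))); rewrite eD; by field.
rewrite exprMn eD.
have -> : 6 * (g * al) * (g * be) * (g * ga) = 6 * g ^+ 2 * g * (al * be * ga) by ring.
have g23 : g = 2 / 3.
  apply/eqP; rewrite -(@eqrXn2 _ 2) ?ltW // ?divr_gt0 ?ltr0n //; apply/eqP.
  by rewrite g49; field.
by rewrite g23; field.
Qed.

End Stationary.
End ClosestProductState.

(** * The equality case *)

Section EqualityCase.
Variable C : numClosedFieldType.
Implicit Types (U V : 'M[C]_2) (psi phi : state3 C) (a x y z : qubit C) (g : C).

Lemma local_op_W U1 U2 U3 i j k : local_op U1 U2 U3 (@Wstate C) i j k =
  (sqrtC 3)^-1 * (U1 i 1 * U2 j 0 * U3 k 0 + U1 i 0 * U2 j 1 * U3 k 0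
                  + U1 i 0 * U2 j 0 * U3 k 1).
Proof. by rewrite /local_op /Wstate !sum2 /=; ring. Qed.

(* The first row, (sqrt (2/3), sqrt (1/3)), is the factor of a closest product
   state of W. *)
Definition Wframe (f : C) : 'M[C]_2 := \matrix_(i, j)
  if i == 0 then if j == 0 then sqrtC 2 / sqrtC 3 else (sqrtC 3)^-1
  else if j == 0 then f / sqrtC 3 else - (f * (sqrtC 2 / sqrtC 3)).

Lemma unitary2_Wframe f : `|f| = 1 -> unitary2 (Wframe f).
Proof.
move=> nf; have fc : f * f^* = 1 by rewrite -normCK nf expr1n.
have r2 := sq_sqrtC3 C.
have rc : ((sqrtC 3)^-1)^* = (sqrtC 3)^-1 :> C by apply: geC0_conj; rewrite invr_ge0 sqrtC_ge0.
have s2 : sqrtC 2 ^+ 2 = 2 :> C by rewrite sqrtCK.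
have sc : (sqrtC 2)^* = sqrtC 2 :> C by apply: geC0_conj; rewrite sqrtC_ge0.
apply/matrixP => i j; rewrite !mxE !sum2 !mxE.
move: (_^-1) (sqrtC 2) r2 rc s2 sc => r s r2 rc s2 sc.
have r3 : 3 * r ^+ 2 = 1 by rewrite r2 divff // pnatr_eq0.
case: (ord2P i) (ord2P j) => -> [] -> /=; rewrite ?rmorphN ?rmorphM /= ?rc ?sc.
all: by ring: r3 s2 fc.
Qed.

(** Frames with phases f1, f2, f3 send W to a state with coefficients - f2 f3 / 3, - f1 f3 / 3, - f1
    f2 / 3 at 011, 101, 110 and - sqrt 2 f1 f2 f3 / 3 at 111. Matching these is solvable exactly
    because of the relation on the square of the 111 coefficient, which reads F^2 = al be ga. *)
Lemma W_of_canonical phi : phi 0 0 0 = 2 / 3 ->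
  phi 1 0 0 = 0 -> phi 0 1 0 = 0 -> phi 0 0 1 = 0 ->
  `|3 * phi 0 1 1| = 1 -> `|3 * phi 1 0 1| = 1 -> `|3 * phi 1 1 0| = 1 ->
  phi 1 1 1 ^+ 2 = - (6 * phi 0 1 1 * phi 1 0 1 * phi 1 1 0) ->
  exists V1 V2 V3, [/\ unitary2 V1, unitary2 V2, unitary2 V3 &
    forall i j k, phi i j k = local_op V1 V2 V3 (@Wstate C) i j k].
Proof.
move=> p0 z1 z2 z3 na nb nc ed.
have scale (t : C) : `|3 * t| = 1 -> exists2 t', `|t'| = 1 & t = - (t' / 3).
  by move=> nt; exists (- (3 * t)); [rewrite normrN|field].
have [[al ma ea] [be mb eb] [ga mc ec]] := And3 (scale _ na) (scale _ nb) (scale _ nc).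
have nz (t : C) : `|t| = 1 -> t != 0 by move=> t1; rewrite -normr_eq0 t1 oner_neq0.
have s2 : sqrtC 2 ^+ 2 = 2 :> C by rewrite sqrtCK.
have [F eF] : exists F, phi 1 1 1 = - (sqrtC 2 * F / 3).
  by exists (- 3 / 2 * sqrtC 2 * phi 1 1 1); field: s2.
have F2 : F ^+ 2 = al * be * ga.
  have := ed; rewrite eF ea eb ec sqrrN !exprMn s2 => h.
  apply: (mulfI (mulf_neq0 (lt0r_neq0 (ltr0n C 2)) (expf_neq0 2 (invr_neq0 (lt0r_neq0 (ltr0n C 3)))))).
  by rewrite -mulrA [_ ^+ 2 * F ^+ 2]mulrC mulrA h; field.
have nF : `|F| = 1 by apply/eqP; rewrite -sqrp_eq1 // -normrX F2 !normrM ma mb mc !mulr1.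
have nd t : `|t| = 1 -> `|F / t| = 1 by move=> t1; rewrite normrM normfV t1 nF divr1.
exists (Wframe (F / al)), (Wframe (F / be)), (Wframe (F / ga)).
split; try by apply/unitary2_Wframe/nd.
have [an bn gn] := And3 (nz _ ma) (nz _ mb) (nz _ mc).
have r2 := sq_sqrtC3 C.
have fbc : (F / be) * (F / ga) = al by rewrite mulf_div -expr2 F2; field; rewrite bn gn.
have fac : (F / al) * (F / ga) = be by rewrite mulf_div -expr2 F2; field; rewrite an gn.
have fab : (F / al) * (F / be) = ga by rewrite mulf_div -expr2 F2; field; rewrite an bn.
have fabc : (F / al) * (F / be) * (F / ga) = F.
  by rewrite fab; field.
move=> i j k; rewrite local_op_W !mxE.
move: (F / al) (F / be) (F / ga) fbc fac fab fabc => f1 f2 f3 fbc fac fab fabc.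
move: (_^-1) r2 (sqrtC 2) s2 eF => r r2 s s2 eF.
(* Writing 1/3 this way makes both sides homogeneous of degree 4 in r, so only s^2 = 2 is left for
   [ring]. *)
have r4 : 3^-1 = 3 * r ^+ 4 by rewrite (exprM r 2 2) r2; field.
rewrite r4 in ea eb ec eF p0.
case: (ord2P i) (ord2P j) (ord2P k) => -> [] -> [] -> /=;
  rewrite ?p0 ?z1 ?z2 ?z3 ?eF ?ea ?eb ?ec -?fabc -?fbc -?fac -?fab.
all: by ring: s2.
Qed.

End EqualityCase.

(** * Optimality and uniqueness of W *)

Theorem theorem1 (C : numClosedFieldType) :
  [/\ normalized3 (@Wstate C) /\ is_G (@Wstate C) (2 / 3)
        /\ E_G (2 / 3 : C) = 5 / 9,
      (forall (psi : state3 C) (g : C), normalized3 psi -> is_G psi g ->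
          4 / 9 <= g ^+ 2 /\ E_G g <= 5 / 9) &
      (forall (psi : state3 C) (g : C), normalized3 psi -> is_G psi g ->
          (g ^+ 2 = 4 / 9 <->
           exists (U1 U2 U3 : 'M[C]_2) (c : C),
             [/\ unitary2 U1, unitary2 U2, unitary2 U3, `|c| = 1 &
                 forall i j k, psi i j k = c * local_op U1 U2 U3 (@Wstate C) i j k]))].
Proof.
split.
- split; first exact: W_normalized.
  by split; [exact: W_G|rewrite /E_G; field].
- move=> psi g npsi Gpsi.
  have [U1 [U2 [U3 [c [phi [_ [_ Gphi nphi phi0]]]]]]] := max_frame npsi Gpsi.
  have [g49 _] := G_lower_bound nphi Gphi phi0.
  split=> //; rewrite /E_G (_ : 5 / 9 = 1 - 4 / 9); last by field.
  by rewrite lerD2l lerN2.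
- move=> psi g npsi Gpsi; split=> [g49|[U1 [U2 [U3 [c [u1 u2 u3 nc e]]]]]].
    have [U1 [U2 [U3 [c [phi [[u1 u2 u3 nc] [epsi Gphi nphi phi0]]]]]]] := max_frame npsi Gpsi.
    have [_ /(_ g49) [na nb nd ed]] := G_lower_bound nphi Gphi phi0.
    have [z1 z2 z3] := stationary nphi Gphi phi0.
    have g23 : g = 2 / 3.
      apply/eqP; rewrite -(@eqrXn2 _ 2) ?(ltW (G_gt0 nphi Gphi)) ?divr_ge0 ?ler0n //; apply/eqP.
      by rewrite g49; field.
    rewrite g23 in phi0.
    have [V1 [V2 [V3 [v1 v2 v3 ephi]]]] := W_of_canonical phi0 z1 z2 z3 na nb nd ed.
    exists (U1 *m V1), (U2 *m V2), (U3 *m V3), c.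
    split; rewrite ?unitary2M //; try exact: unitary2M.
    by move=> i j k; rewrite epsi (eq_local_op _ _ _ ephi) local_opM.
  (* Converse: invariance under local unitaries gives [psi] the maximal overlap 2/3 of W, and this
     value is unique. *)
  have := is_G_local_op u1 u2 u3 nc e (W_G C).
  by move=> /(is_G_uniq Gpsi) ->; field.
Qed.
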